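(* Let $F:A^{\mathbb{Z}}\to A^{\mathbb{Z}}$ be a sensitive cellular automaton and let $\mu$ be a probability measure on the Borel sets of $A^{\mathbb{Z}}$ that is invariant under both the shift $\sigma$ and $F$. If $I^+_\mu+I^-_\mu=0$, then $h_\mu(F)=0$.
   Context: $A$ is a finite alphabet; $A^{\mathbb{Z}}$ is the set of bi-infinite sequences $x=(x_i)_{i\in\mathbb{Z}}$ with the metric $d(x,y)=2^{-i}$, $i=\min\{|j|: x_j\neq y_j\}$ (and $d(x,x)=0$). The shift is $\sigma(x)_i=x_{i+1}$. A cellular automaton is a continuous map $F:A^{\mathbb{Z}}\to A^{\mathbb{Z}}$ commuting with $\sigma$. $h_\mu(F)$ is the measure-theoretic (Kolmogorov–Sinai) entropy. $F$ is sensitive if there is $\epsilon>0$ such that for all $x\in A^{\mathbb{Z}}$ and all $\delta>0$ there are $y\in A^{\mathbb{Z}}$ with $d(x,y)\le\delta$ and $n\in\mathbb{N}$ with $d(F^n(x),F^n(y))\ge\epsilon$. For $x\in A^{\mathbb{Z}}$ and $s\in\mathbb{Z}$ let $W_s^+(x)=\{y\in A^{\mathbb{Z}}:\forall i\ge s,\ y_i=x_i\}$ and $W_s^-(x)=\{y\in A^{\mathbb{Z}}:\forall i\le s,\ y_i=x_i\}$. For $n\ge 1$ let $$I^-_n(x)=\min\{s\in\mathbb{N}:\forall 1\le i\le n,\ F^i(W^-_s(x))\subset W^-_0(F^i(x))\},$$ $$I^+_n(x)=\min\{s\in\mathbb{N}:\forall 1\le i\le n,\ F^i(W^+_{-s}(x))\subset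 W^+_0(F^i(x))\},$$ where $\mathbb{N}$ contains $0$. The average Lyapunov exponents are $I^{\pm}_\mu=\liminf_{n\to\infty}\frac1n\int_{A^{\mathbb{Z}}} I^{\pm}_n(x)\,d\mu(x)$. *)

(* Defs.v *)
From HB Require Import structures.
From mathcomp Require Import all_boot all_order all_algebra.
From mathcomp Require Import all_classical all_reals all_analysis.

Set Implicit Arguments.
Unset Strict Implicit.
Unset Printing Implicit Defensive.

Import Order.TTheory GRing.Theory Num.Theory.
Import numFieldNormedType.Exports.

Local Open Scope classical_set_scope.
Local Open Scope ring_scope.

(* A measurableType is pointed, whence pointed (i.e. nonempty) alphabets; no
   definition below depends on the chosen point. *)
#[short(type="finPointedType")]
HB.structure Definition FinPointed := {A of Finite A & isPointed A}.

(* Junk value 0 when S is empty. *)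
Definition nat_min (S : set nat) : nat :=
  xget 0%N [set s | S s /\ forall t, S t -> (s <= t)%N].

Lemma nat_minP (S : set nat) :
  S !=set0 -> S (nat_min S) /\ forall t, S t -> (nat_min S <= t)%N.
Proof.
move=> [t St].
have ex : exists s, `[< S s >] by exists t; apply/asboolP.
apply: (@xgetPex _ 0%N [set s | S s /\ forall t, S t -> (s <= t)%N]).
case: (ex_minnP ex) => m /asboolP Sm mmin.
by exists m; split=> // u Su; apply: mmin; apply/asboolP.
Qed.

(* The real field R is a phantom parameter: it is the codomain of the distance
   defining the topology. *)
Definition fullshift (R : realType) (A : finPointedType) : Type := int -> A.

Section fullshift_metric.
Context {R : realType} {A : finPointedType}.
Implicit Types x y z : fullshift R A.

HB.instance Definition _ := Choice.copy (fullshift R A) (int -> A).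
HB.instance Definition _ := Pointed.copy (fullshift R A) (int -> A).

Definition diff_abs x y : set nat := [set absz j | j in [set j | x j <> y j]].

Definition shift_dist x y : R :=
  if x == y then 0 else 2 ^- nat_min (diff_abs x y).

Lemma diff_abs_neq0 x y : x != y -> diff_abs x y !=set0.
Proof.
move=> /eqP xy; apply: contrapT => /set0P/negP/negPn/eqP d0; apply: xy.
apply/funext => j; apply: contrapT => xyj.
have : diff_abs x y (absz j) by exists j.
by rewrite d0.
Qed.

Lemma diff_abs_sym x y : diff_abs x y = diff_abs y x.
Proof.
by rewrite /diff_abs; congr (_ @` _); apply/seteqP; split=> j /= /nesym.
Qed.

Lemma shift_distxx x : shift_dist x x = 0.
Proof. by rewrite /shift_dist eqxx. Qed.

Lemma shift_dist_ge0 x y : 0 <= shift_dist x y.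
Proof. by rewrite /shift_dist; case: ifP => // _; rewrite invr_ge0 exprn_ge0. Qed.

Lemma shift_dist_eq0 x y : shift_dist x y = 0 -> x = y.
Proof.
rewrite /shift_dist; case: eqP => // _ /eqP.
by rewrite invr_eq0 expf_eq0 pnatr_eq0 andbF.
Qed.

Lemma shift_dist_sym x y : shift_dist x y = shift_dist y x.
Proof. by rewrite /shift_dist eq_sym diff_abs_sym. Qed.

Lemma shift_dist_le x y j : x j <> y j -> 2 ^- absz j <= shift_dist x y.
Proof.
move=> xyj; rewrite /shift_dist; case: eqP => [xy|_]; first by rewrite xy in xyj.
rewrite lef_pV2 ?posrE ?exprn_gt0// ler_eXn2l ?ltr1n//.
have dj : diff_abs x y (absz j) by exact: imageP.
by have [_] := nat_minP (ex_intro _ _ dj); exact.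
Qed.

Lemma shift_dist_triangle y x z :
  shift_dist x z <= shift_dist x y + shift_dist y z.
Proof.
have [->|xz] := eqVneq x z.
  by rewrite shift_distxx addr_ge0 ?shift_dist_ge0.
have [[j xzj jmin] _] := nat_minP (diff_abs_neq0 xz).
rewrite {1}/shift_dist (negbTE xz) -jmin.
have [xyj|xyj] := pselect (x j = y j).
  by apply: ler_wpDl; [exact: shift_dist_ge0|apply: shift_dist_le; rewrite -xyj].
by apply: ler_wpDr; [exact: shift_dist_ge0|exact: shift_dist_le].
Qed.

HB.instance Definition _ := isMetric.Build R (fullshift R A)
  shift_distxx shift_dist_eq0 shift_dist_sym shift_dist_triangle.

Definition shift_map x : fullshift R A := fun i => x (i + 1).

Definition cellular_automaton (F : fullshift R A -> fullshift R A) : Prop :=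
  continuous F /\ forall x, F (shift_map x) = shift_map (F x).

Definition Wplus (s : int) x : set (fullshift R A) :=
  [set y | forall i : int, s <= i -> y i = x i].

Definition Wminus (s : int) x : set (fullshift R A) :=
  [set y | forall i : int, i <= s -> y i = x i].

(* For a cellular automaton both sets below are nonempty, since F ^ i is given
   by a local rule, so the junk value of nat_min plays no role. *)
Definition Iminus (F : fullshift R A -> fullshift R A) (n : nat) x : nat :=
  nat_min [set s | forall i, (1 <= i <= n)%N ->
    iter i F @` Wminus s%:Z x `<=` Wminus 0 (iter i F x)].

Definition Iplus (F : fullshift R A -> fullshift R A) (n : nat) x : nat :=
  nat_min [set s | forall i, (1 <= i <= n)%N ->
    iter i F @` Wplus (- s%:Z) x `<=` Wplus 0 (iter i F x)].

End fullshift_metric.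

Definition sensitive {R : realType} {X : metricType R} (F : X -> X) : Prop :=
  exists2 eps : R, 0 < eps & forall (x : X) (delta : R), 0 < delta ->
    exists y : X, mdist x y <= delta /\
      exists n : nat, eps <= mdist (iter n F x) (iter n F y).

Definition borel_fullshift (R : realType) (A : finPointedType) :=
  g_sigma_algebraType (@open (fullshift R A)).

HB.instance Definition _ (R : realType) (A : finPointedType) :=
  Measurable.on (borel_fullshift R A).

Section average_exponents.
Context {R : realType} {A : finPointedType}.
Variables (mu : probability (borel_fullshift R A) R).
Variable F : fullshift R A -> fullshift R A.
Local Open Scope ereal_scope.

Definition avg_lyap_minus : \bar R :=
  limn_einf (fun n => (n%:R^-1)%:E * \int[mu]_x ((Iminus F n x)%:R)%:E).

Definition avg_lyap_plus : \bar R :=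
  limn_einf (fun n => (n%:R^-1)%:E * \int[mu]_x ((Iplus F n x)%:R)%:E).

End average_exponents.

Section entropy.
Context {d : measure_display} {X : measurableType d} {R : realType}.
Variable mu : probability X R.

Definition invariant_measure (T : X -> X) : Prop :=
  forall B, measurable B -> mu (T @^-1` B) = mu B.

Definition measurable_partition (k : nat) (P : 'I_k -> set X) : Prop :=
  [/\ forall i, measurable (P i), trivIset setT P & \bigcup_i P i = setT].

(* 0 ln 0 = 0, since ln 0 = 0 in the library. *)
Definition partition_entropy (I : finType) (P : I -> set X) : R :=
  - \sum_(i : I) fine (mu (P i)) * ln (fine (mu (P i))).

(* The join of the partitions T^-i P for i < n. *)
Definition iterated_join (T : X -> X) (k : nat) (P : 'I_k -> set X) (n : nat)
    (w : {ffun 'I_n -> 'I_k}) : set X :=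
  \bigcap_(i in [set: 'I_n]) (iter i T @^-1` P (w i)).

(* The limit exists, by subadditivity, whenever mu is T-invariant. *)
Definition entropy_along (T : X -> X) (k : nat) (P : 'I_k -> set X) : R :=
  limn (fun n => n%:R^-1 * partition_entropy (@iterated_join T k P n)).

Definition ks_entropy (T : X -> X) : \bar R :=
  ereal_sup [set e | exists (k : nat) (P : 'I_k -> set X),
    measurable_partition P /\ e = (entropy_along T P)%:E].

End entropy.

(* Main.v *)
Require Import Defs.
From mathcomp Require Import all_boot all_order all_algebra.
From mathcomp Require Import all_classical all_reals all_analysis.
From mathcomp Require Import measurable_realfun zify ring lra.

(** The entropy of [F] along a finite partition is the growth rate of the Shannon
    entropy of itineraries of length [m], so it vanishes once itineraries can be
    encoded with [o(m)] nats on average.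

    Up to an error of small measure, a finite partition can be read off a window
    [-p, p] of the configuration, where [p] may be taken at least the radius of
    [F] ([local_label_small_error]); the cost of correcting the errors is a
    small multiple of [m]. What remains is to encode the window of [F^t x] for
    all [t <= m]. The exponents tell how far beyond the window one has to look:
    knowing [x] up to [p + I^-] protects the coordinates at most [p] from
    whatever lies further to the right, and knowing [x] down to [-p - I^+]
    protects the coordinates at least [-p] from whatever lies further to the
    left.

    Both lower limits are zero, but possibly along different sequences of times,
    so one cannot choose a single time at which both means are small. Two time
    scales settle this. Choose [n] at which the mean of [I^+_n] is a small
    multiple of [n], and then a much larger [m] at which the mean of [I^-_m] is a
    small multiple of [m]. The word of [x] on [-p, p + I^-_m] controls the right
    side once and for all, while the left side is controlled afresh at the
    times [k n]: the words of [F^(kn) x] on [-p - I^+_n, p] complete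
    the description ([side_words_determine_column]). The two kinds of control can
    be combined because the window is at least two radii wide, so that neither
    side can act on the other without being seen in it ([orbit_gluing]).

    A word of random length costs at most a constant times one plus its mean
    length ([shannon_padded_word]). Since [mu] is invariant under
    the shift and under [F], all the words above have the mean lengths given by the
    exponents, and adding up their costs gives a bound [m e] on the entropy of
    itineraries of length [m], for [e > 0] arbitrary
    ([shannon_itinerary_exponents]). Cutting longer itineraries into blocks of
    length [m] transfers this bound to the growth rate ([entropy_rate0]). *)

Set Implicit Arguments.
Unset Strict Implicit.
Unset Printing Implicit Defensive.

Import Order.TTheory GRing.Theory Num.Theory.
Import numFieldNormedType.Exports.

Local Open Scope classical_set_scope.
Local Open Scope ring_scope.

(** * Shannon entropy of finite-valued functions *)

Section finite_valued.
Context {d : measure_display} {X : measurableType d} {R : realType}.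
Variable mu : probability X R.

Definition fin_meas (T : finType) (f : X -> T) : Prop :=
  forall t, measurable (f @^-1` [set t]).

Definition law (T : finType) (f : X -> T) (t : T) : R :=
  fine (mu (f @^-1` [set t])).

Definition shannon (T : finType) (f : X -> T) : R :=
  partition_entropy mu (fun t => f @^-1` [set t]).

Lemma law_ge0 (T : finType) (f : X -> T) t : 0 <= law f t.
Proof. exact/fine_ge0/measure_ge0. Qed.

Lemma fin_meas_preimage (T : finType) (f : X -> T) (B : set T) :
  fin_meas f -> measurable (f @^-1` B).
Proof.
move=> mf; have -> : f @^-1` B = \bigcup_(t in B) f @^-1` [set t].
  by apply/seteqP; split=> [x Bx|x [t Bt /= ->]//]; exists (f x).
by apply: fin_bigcup_measurable => // t _.
Qed.

Lemma fin_meas_determined (T U : finType) (f : X -> T) (g : X -> U) :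
  fin_meas f -> (forall x y, f x = f y -> g x = g y) -> fin_meas g.
Proof.
move=> mf fg u.
have -> : g @^-1` [set u] = f @^-1` (f @` (g @^-1` [set u])).
  apply/seteqP; split=> [x gx|x [y /= gy /fg <-]//]; first by exists x.
exact: fin_meas_preimage.
Qed.

Lemma fin_meas_pair (T U : finType) (f : X -> T) (g : X -> U) :
  fin_meas f -> fin_meas g -> fin_meas (fun x => (f x, g x)).
Proof.
move=> mf mg [t u].
have -> : (fun x => (f x, g x)) @^-1` [set (t, u)] =
    f @^-1` [set t] `&` g @^-1` [set u].
  by apply/seteqP; split=> x /= [-> ->].
exact: measurableI.
Qed.

Lemma fin_meas_ffun (I T : finType) (f : I -> X -> T) :
  (forall i, fin_meas (f i)) -> fin_meas (fun x => [ffun i => f i x]).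
Proof.
move=> mf w.
have -> : (fun x => [ffun i => f i x]) @^-1` [set w] =
    \bigcap_(i in [set: I]) f i @^-1` [set w i].
  apply/seteqP; split=> [x /= <- i _ /=|x fx /=]; first by rewrite ffunE.
  by apply/ffunP => i; rewrite ffunE fx.
by apply: fin_bigcap_measurable => // i _; exact: mf.
Qed.

Lemma fine_muE (B : set X) : measurable B -> (fine (mu B))%:E = mu B.
Proof. by move=> mB; rewrite fineK// fin_num_measure. Qed.

Lemma fine_mu_le (B C : set X) : measurable B -> measurable C -> B `<=` C ->
  fine (mu B) <= fine (mu C).
Proof.
move=> mB mC BC; apply: fine_le; rewrite ?fin_num_measure//.
by apply: le_measure => //; rewrite inE.
Qed.

(** The law of [phi \o f] is the image of the law of [f]; through this, sums over
    values play the part of integrals for finite-valued functions. *)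
Lemma law_comp (T U : finType) (f : X -> T) (phi : T -> U) u : fin_meas f ->
  law (phi \o f) u = \sum_(t | phi t == u) law f t.
Proof.
move=> mf.
have key (s : seq T) : uniq s ->
    fine (mu (f @^-1` [set t | t \in s])) = \sum_(t <- s) law f t.
  elim: s => [_|t s IH /= /andP[ts us]].
    rewrite big_nil; have -> : f @^-1` [set t | t \in [::]] = set0.
      by apply/seteqP; split.
    by rewrite measure0.
  rewrite big_cons -IH// /law -fineD ?fin_num_measure//;
    try exact: fin_meas_preimage.
  rewrite -measureU//; try exact: fin_meas_preimage.
    congr (fine (mu _)); apply/seteqP; split=> x /=.
      by rewrite inE => /orP[/eqP|]; [left|right].
    by rewrite inE => -[->|->]; rewrite ?eqxx ?orbT.
  by apply/seteqP; split=> // x /= [-> st]; rewrite st in ts.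
rewrite -big_filter -key ?filter_uniq ?index_enum_uniq//.
congr (fine (mu _)); apply/seteqP; split=> x /=.
  by move=> <-; rewrite mem_filter mem_index_enum eqxx.
by rewrite mem_filter => /andP[/eqP].
Qed.

Lemma law_le_comp (T U : finType) (f : X -> T) (phi : T -> U) t : fin_meas f ->
  law f t <= law (phi \o f) (phi t).
Proof.
move=> mf; rewrite law_comp// (bigD1 t)//= lerDl.
by apply: sumr_ge0 => i _; exact: law_ge0.
Qed.

Lemma sum_law_comp (T U : finType) (f : X -> T) (phi : T -> U) (h : U -> R) :
  fin_meas f ->
  \sum_u law (phi \o f) u * h u = \sum_t law f t * h (phi t).
Proof.
move=> mf; rewrite (partition_big phi predT)//=; apply: eq_bigr => u _.
by rewrite law_comp// mulr_suml; apply: eq_bigr => t /eqP ->.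
Qed.

Lemma sum_law (T : finType) (f : X -> T) : fin_meas f -> \sum_t law f t = 1.
Proof.
move=> mf; have := @law_comp _ unit f (fun=> tt) tt mf.
rewrite (eq_bigl xpredT) => [<-|]//.
rewrite /law; have -> : ((fun=> tt) \o f) @^-1` [set tt] = setT by exact/seteqP.
by rewrite probability_setT.
Qed.

Lemma shannonE (T : finType) (f : X -> T) :
  shannon f = \sum_t law f t * - ln (law f t).
Proof.
by rewrite /shannon /partition_entropy -sumrN; apply: eq_bigr => t _; rewrite mulrN.
Qed.

Lemma law_le1 (T : finType) (f : X -> T) t : fin_meas f -> law f t <= 1.
Proof.
move=> mf; rewrite -(sum_law mf) (bigD1 t)//= lerDl.
by apply: sumr_ge0 => i _; exact: law_ge0.
Qed.

Lemma shannon_ge0 (T : finType) (f : X -> T) : fin_meas f -> 0 <= shannon f.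
Proof.
move=> mf; rewrite shannonE; apply: sumr_ge0 => t _.
by rewrite mulr_ge0 ?law_ge0// oppr_ge0 ln_le0// law_le1.
Qed.

(** Shannon's bound by code lengths: if [len] satisfies Kraft's inequality on
    the values of positive probability, the entropy is at most the mean length.
    Subadditivity and the costs of all the codes below rest on it. *)
Lemma shannon_kraft (T : finType) (f : X -> T) (S : pred T) (len : T -> R) :
  fin_meas f -> (forall t, law f t != 0 -> S t) ->
  \sum_(t | S t) expR (- len t) <= 1 ->
  shannon f <= \sum_t law f t * len t.
Proof.
move=> mf fS kraft; rewrite shannonE -subr_le0 -sumrB.
rewrite (bigID S)/= [X in _ + X]big1 ?addr0; last first.
  move=> t St; have [->|/fS] := eqVneq (law f t) 0; last by rewrite (negPf St).
  by rewrite !mul0r subrr.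
have sumS : \sum_(t | S t) law f t = 1.
  rewrite -(sum_law mf) [RHS](bigID S)/= [X in _ + X]big1 ?addr0// => t St.
  by apply/eqP; apply: contraNT St => /fS.
apply: (@le_trans _ _ (\sum_(t | S t) (expR (- len t) - law f t))); last first.
  by rewrite sumrB sumS subr_le0.
apply: ler_sum => t _; have := law_ge0 f t.
rewrite le_eqVlt => /predU1P[<-|p0]; first by rewrite !mul0r subrr subr0 expR_ge0.
(* p (ln q - ln p) <= q - p is ln y <= y - 1 at y = q / p. *)
rewrite -mulrBr; set p := law f t in p0 *.
have y0 : 0 < expR (- len t) / p by rewrite divr_gt0// expR_gt0.
have := le_ln1Dx (x := expR (- len t) / p - 1).
rewrite addrCA subrr addr0 ltrBrDl subrr => /(_ y0).
rewrite ln_div ?posrE ?expR_gt0// expRK => h.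
have -> : expR (- len t) - p = p * (expR (- len t) / p - 1).
  by rewrite mulrBr mulr1 mulrCA divff ?mulr1// gt_eqF.
rewrite ler_pM2l//; lra.
Qed.

(** Merging values increases each probability, hence decreases [- ln]. *)
Lemma shannon_comp (T U : finType) (f : X -> T) (phi : T -> U) :
  fin_meas f -> shannon (phi \o f) <= shannon f.
Proof.
move=> mf; rewrite !shannonE sum_law_comp//; apply: ler_sum => t _.
have := law_ge0 f t; rewrite le_eqVlt => /predU1P[<-|p0]; first by rewrite !mul0r.
by rewrite ler_pM2l// lerN2 ler_ln ?posrE ?law_le_comp// (lt_le_trans p0)// law_le_comp.
Qed.

Lemma shannon_determined (T U : finType) (f : X -> T) (g : X -> U) :
  fin_meas f -> (forall x y, f x = f y -> g x = g y) ->
  shannon g <= shannon f.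
Proof.
move=> mf fg.
pose phi t := g (xget point (f @^-1` [set t])).
have -> : g = phi \o f.
  apply/funext => x; apply: fg => /=.
  by case: (xgetP point (f @^-1` [set f x])) => [y _ -> //|/(_ x)/(_ erefl)].
exact: shannon_comp.
Qed.

(** Subadditivity is the code-length bound for the lengths
    [- ln (law f t) - ln (law g u)], those of two independent codes. *)
Lemma shannon_pair (T U : finType) (f : X -> T) (g : X -> U) :
  fin_meas f -> fin_meas g ->
  shannon (fun x => (f x, g x)) <= shannon f + shannon g.
Proof.
move=> mf mg; set h := fun x => (f x, g x).
have mh : fin_meas h by exact: fin_meas_pair.
have h1 t : law h t != 0 -> law f t.1 != 0.
  apply: contraNneq => f0; apply/eqP/le_anti.
  by rewrite law_ge0 andbT -f0 (law_le_comp fst t mh).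
have h2 t : law h t != 0 -> law g t.2 != 0.
  apply: contraNneq => f0; apply/eqP/le_anti.
  by rewrite law_ge0 andbT -f0 (law_le_comp snd t mh).
pose S (t : T * U) := (law f t.1 != 0) && (law g t.2 != 0).
have -> : shannon f + shannon g =
    \sum_t law h t * (- ln (law f t.1) + - ln (law g t.2)).
  under [RHS]eq_bigr do rewrite mulrDr.
  rewrite big_split/= -(sum_law_comp fst (fun t => - ln (law f t)) mh).
  by rewrite -(sum_law_comp snd (fun t => - ln (law g t)) mh) -!shannonE.
apply: (@shannon_kraft _ h S) => //; first by move=> t ht; rewrite /S h1// h2.
apply: (@le_trans _ _ (\sum_t law f t.1 * law g t.2)); last first.
  rewrite -(pair_bigA _ (fun t u => law f t * law g u))/=.
  under eq_bigr do rewrite -mulr_sumr (sum_law mg) mulr1.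
  by rewrite sum_law.
rewrite [leRHS](bigID S)/= ler_wpDr ?sumr_ge0//.
  by move=> t _; rewrite mulr_ge0 ?law_ge0.
apply: ler_sum => t /andP[f0 g0].
by rewrite opprD !opprK expRD !lnK// posrE lt_neqAle law_ge0 eq_sym ?f0 ?g0.
Qed.

Lemma fin_meas_cst (T : finType) (t0 : T) : fin_meas (fun=> t0).
Proof.
move=> t; have [->|nt] := pselect (t0 = t).
  by have -> : (fun=> t) @^-1` [set t] = @setT X by exact/seteqP.
by have -> : (fun=> t0) @^-1` [set t] = @set0 X by apply/seteqP; split.
Qed.

Lemma shannon_cst (T : finType) (t0 : T) : shannon (fun=> t0) = 0.
Proof.
apply/eqP; rewrite eq_le shannon_ge0 ?andbT; last exact: fin_meas_cst.
apply: (@le_trans _ _ (shannon (fun=> tt))).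
  exact: shannon_determined (fin_meas_cst tt) _.
rewrite shannonE big1// => -[] _; rewrite /law.
have -> : (fun=> tt) @^-1` [set tt] = @setT X by exact/seteqP.
by rewrite probability_setT ln1 oppr0 mulr0.
Qed.

Lemma shannon_ffun (T : finType) n (f : 'I_n -> X -> T) :
  (forall i, fin_meas (f i)) ->
  shannon (fun x => [ffun i => f i x]) <= \sum_i shannon (f i).
Proof.
elim: n f => [|n IH] f mf.
  rewrite big_ord0 -(shannon_cst tt).
  apply: shannon_determined; first exact: fin_meas_cst.
  by move=> x y _; apply/ffunP => -[].
rewrite big_ord_recl/=; have := IH (fun i => f (lift ord0 i)) (fun i => mf _).
rewrite -(lerD2l (shannon (f ord0))); apply: le_trans.
have mt : fin_meas (fun x => [ffun i => f (lift ord0 i) x]) by exact: fin_meas_ffun.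
apply: le_trans (shannon_pair (mf ord0) mt).
apply: shannon_determined => [|x y [f0 fl]]; first exact: fin_meas_pair.
apply/ffunP => i; rewrite !ffunE; case: (unliftP ord0 i) => [j ->|-> //].
by move/ffunP: fl => /(_ j); rewrite !ffunE.
Qed.

End finite_valued.

(** * Invariance and the cost of codes *)

Section codes.
Context {d : measure_display} {X : measurableType d} {R : realType}.
Variable mu : probability X R.

Lemma fin_meas_measurable_comp (T : finType) (f : X -> T) (g : X -> X) :
  (forall B, measurable B -> measurable (g @^-1` B)) ->
  fin_meas f -> fin_meas (f \o g).
Proof. by move=> mg mf t; rewrite comp_preimage; exact: mg. Qed.

Lemma measurable_iter (T : X -> X) n :
  (forall B, measurable B -> measurable (T @^-1` B)) ->
  forall B, measurable B -> measurable (iter n T @^-1` B).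
Proof.
move=> mT; elim: n => [//|n IH] B mB.
by rewrite -[_ @^-1` B]/(iter n T @^-1` (T @^-1` B)); exact/IH/mT.
Qed.

Lemma invariant_measure_iter (T : X -> X) n :
  (forall B, measurable B -> measurable (T @^-1` B)) ->
  invariant_measure mu T -> invariant_measure mu (iter n T).
Proof.
move=> mT muT; elim: n => [//|n IH] B mB.
by rewrite -[LHS]/(mu (iter n T @^-1` (T @^-1` B))) IH ?muT//; exact: mT.
Qed.

Definition itinerary (T : X -> X) k (lbl : X -> 'I_k) m (x : X) :
    {ffun 'I_m -> 'I_k} :=
  [ffun i : 'I_m => lbl (iter i T x)].

Lemma law_invariant (T : finType) (f : X -> T) (g : X -> X) :
  invariant_measure mu g -> fin_meas f -> law mu (f \o g) = law mu f.
Proof.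
by move=> mug mf; apply/funext => t; rewrite /law comp_preimage mug.
Qed.

Lemma shannon_invariant (T : finType) (f : X -> T) (g : X -> X) :
  invariant_measure mu g -> fin_meas f -> shannon mu (f \o g) = shannon mu f.
Proof. by move=> mug mf; rewrite !shannonE law_invariant. Qed.

Lemma integral_fin_meas (T : finType) (f : X -> T) (h : T -> R) :
  fin_meas f -> (forall t, 0 <= h t) ->
  (\int[mu]_x (h (f x))%:E)%E = (\sum_t law mu f t * h t)%:E.
Proof.
move=> mf h0.
transitivity (\int[mu]_x (\sum_t (h t)%:E * (\1_(f @^-1` [set t]) x)%:E))%E.
  apply: eq_integral => x _; rewrite (bigD1 (f x))//= big1 ?adde0.
    by rewrite indicE mem_set// mule1.
  by move=> t tf; rewrite indicE memNset ?mule0// => /= ft; rewrite ft eqxx in tf.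
rewrite ge0_integral_sum//.
- rewrite -sumEFin; apply: eq_bigr => t _.
  rewrite ge0_integralZl_EFin//.
    by rewrite integral_indic// setIT EFinM muleC fine_muE.
  by apply/measurable_EFinP; exact: measurable_indic.
- move=> t; apply: measurable_funeM.
  by apply/measurable_EFinP; exact: measurable_indic.
- by move=> t x _; rewrite mule_ge0// lee_fin.
Qed.

(** The value [t0] receives the short length [e / 2], which leaves
    [1 - expR (- e / 2)] in Kraft's inequality to be shared by the other values,
    at a fixed length [L]; these then contribute at most [delta * L]. *)
Lemma shannon_concentrated (T : finType) (t0 : T) (e : R) : 0 < e ->
  exists2 delta : R, 0 < delta & forall f : X -> T, fin_meas f ->
    \sum_(t | t != t0) law mu f t <= delta -> shannon mu f <= e.
Proof.
move=> e0; pose eta := e / 2; have eta0 : 0 < eta by rewrite divr_gt0.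
have gap : 0 < 1 - expR (- eta) by rewrite subr_gt0 expR_lt1 oppr_lt0.
have T0 : 0 < #|T|%:R :> R by rewrite ltr0n; apply/card_gt0P; exists t0.
pose L := Num.max 1 (ln (#|T|%:R / (1 - expR (- eta)))).
have L1 : 1 <= L by rewrite le_max lexx.
have L0 : 0 < L by exact: lt_le_trans L1.
exists (eta / L) => [|f mf fd]; first by rewrite divr_gt0.
pose len t := if t == t0 then eta else L.
apply: (@le_trans _ _ (\sum_t law mu f t * len t)).
  apply: (shannon_kraft (S := predT)) => //.
  rewrite (bigD1 t0)//= /len eqxx.
  rewrite (eq_bigr (fun=> expR (- L))); last by move=> t /negPf ->.
  rewrite sumr_const -[leRHS](subrKC (expR (- eta))) lerD2l.
  apply: (@le_trans _ _ (#|T|%:R * expR (- L))).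
    by rewrite mulr_natl ler_pMn2l ?expR_gt0// max_card.
  rewrite (expRN L) ler_pdivrMr ?expR_gt0// mulrC -ler_pdivrMr//.
  rewrite -[leLHS]lnK ?posrE ?divr_gt0// ler_expR le_max lexx orbT//.
rewrite (bigD1 t0)//= {1}/len eqxx.
rewrite (eq_bigr (fun t => law mu f t * L)); last by move=> t; rewrite /len => /negPf ->.
rewrite -mulr_suml (splitr e) lerD//.
  by rewrite ler_piMl// ?law_le1// ltW.
by rewrite -ler_pdivlMr.
Qed.

Lemma sum_geometric_half n : \sum_(i < n) (2 ^- i.+1 : R) = 1 - 2 ^- n.
Proof.
elim: n => [|n IH]; first by rewrite big_ord0 expr0 invr1 subrr.
rewrite big_ord_recr/= IH exprS invfM.
have : 0 < (2 ^- n : R) by rewrite invr_gt0 exprn_gt0.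
by set y := (X in 0 < X); move=> _; field.
Qed.

Lemma card_padded (A : finType) (a0 : A) K j :
  (#|[pred w : {ffun 'I_K -> A} | [forall i : 'I_K, (j <= i)%N ==> (w i == a0)]]|
     <= #|A| ^ j)%N.
Proof.
have A0 : (0 < #|A|)%N by apply/card_gt0P; exists a0.
have le : (#|[pred i : 'I_K | (i < j)%N]| <= j)%N.
  rewrite cardE -(size_map val) -[leqRHS](size_iota 0) uniq_leq_size//.
    by rewrite map_inj_uniq ?enum_uniq//; exact: val_inj.
  by move=> i /mapP[k]; rewrite mem_enum inE => kj ->; rewrite mem_iota.
apply: leq_trans (leq_pexp2l A0 le); rewrite -(card_pffun_on a0 _ predT).
apply: subset_leq_card; apply/fintype.subsetP => w; rewrite !inE => /forallP wP.
apply/pffun_onP; split=> //; apply/fintype.subsetP => i; rewrite !inE.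
by apply: contraNT; rewrite -leqNgt => ji; have := wP i; rewrite ji.
Qed.

(** The pair formed by an integer [l] and a word of length [c + l], padded with
    [a0] so as to have a finite type of values, is given the length
    [(c + 1 + l) * ln (2 * #|A|)]. The factor [#|A|] pays for the letters and the
    factor 2 for announcing [l], so the bound does not involve the range [N]
    of [l]. *)
Lemma shannon_padded_word (A : finType) (a0 : A) N K c
    (f : X -> 'I_N * {ffun 'I_K -> A}) :
  fin_meas f ->
  (forall x (i : 'I_K), (c + (f x).1 <= i)%N -> (f x).2 i = a0) ->
  shannon mu f <= (c.+1%:R + \sum_l law mu (fst \o f) l * l%:R) * ln (2 * #|A|%:R).
Proof.
move=> mf fpad; set a : R := #|A|%:R.
have A0 : (0 < #|A|)%N by apply/card_gt0P; exists a0.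
have a1 : 1 <= a by rewrite ler1n.
have a2 : 0 < 2 * a by rewrite mulr_gt0// (lt_le_trans ltr01).
pose len (t : 'I_N * {ffun 'I_K -> A}) : R := (c.+1 + t.1)%:R * ln (2 * a).
pose S (t : 'I_N * {ffun 'I_K -> A}) : bool :=
  [forall i : 'I_K, (c + t.1 <= i)%N ==> (t.2 i == a0)].
have -> : (c.+1%:R + \sum_l law mu (fst \o f) l * l%:R) * ln (2 * a) =
    \sum_t law mu f t * len t.
  rewrite (sum_law_comp mu fst (fun l : 'I_N => l%:R : R) mf).
  have -> : \sum_t law mu f t * len t =
      \sum_t (law mu f t * c.+1%:R + law mu f t * t.1%:R) * ln (2 * a).
    by apply: eq_bigr => t _; rewrite /len natrD; ring.
  by rewrite -mulr_suml big_split/= -mulr_suml sum_law// mul1r.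
apply: (shannon_kraft (S := S)) => //.
  move=> t; apply: contraNT => St; rewrite /law.
  suff -> : f @^-1` [set t] = set0 by rewrite measure0.
  apply/seteqP; split=> // x /= fx; move/negP: St; apply.
  by apply/forallP => i; apply/implyP => ci; rewrite -fx fpad// fx.
have lenE t : expR (- len t) = (2 * a) ^- (c.+1 + t.1).
  by rewrite expRN /len -[X in X%:R]muln1 natrM mulr1 expRM_natl lnK ?posrE.
under eq_bigr do rewrite lenE.
rewrite big_mkcond/= -(pair_bigA _ (fun (l : 'I_N) w => if S (l, w) then (2 * a) ^- (c.+1 + l) else 0))/=.
apply: (@le_trans _ _ (\sum_(l < N) 2 ^- l.+1)); last first.
  by rewrite sum_geometric_half lerBlDr lerDl invr_ge0 exprn_ge0.
(* There are at most [#|A| ^ (c + l)] padded words for each [l]. *)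
apply: ler_sum => l _; rewrite -big_mkcond/= sumr_const.
apply: (@le_trans _ _ ((2 * a) ^- (c.+1 + l) *+ #|A| ^ (c + l))).
  apply: ler_wpMn2l; first by rewrite invr_ge0 exprn_ge0// ltW.
  by apply: leq_trans (card_padded a0 K (c + l)); apply/eq_leq/eq_card => w.
rewrite -[X in X <= _]mulr_natl natrX -/a exprMn invfM mulrCA.
rewrite -[X in _ <= X]mulr1 ler_pM ?invr_ge0 ?exprn_ge0//.
- by rewrite mulr_ge0 ?invr_ge0 ?exprn_ge0// (le_trans ler01).
- rewrite lef_pV2 ?posrE ?exprn_gt0// ler_eXn2l ?ltr1n//; lia.
- rewrite ler_pdivrMr ?exprn_gt0 ?(lt_le_trans ltr01)// mul1r.
  by rewrite ler_weXn2l//; lia.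
Qed.

End codes.

(** * Local rules, exponents and gluing of orbits *)

Section symbolic.
Context {R : realType} {A : finPointedType}.
Implicit Types (x y z w : fullshift R A) (F : fullshift R A -> fullshift R A).

Lemma nbhs_fullshift x (U : set (fullshift R A)) :
  nbhs x U <-> exists p : nat,
    forall y, (forall i : int, - p%:Z <= i <= p%:Z -> y i = x i) -> U y.
Proof.
split=> [/(@nbhs_ballP R)[e /= e0 xU]|[p xU]].
  have [p pe] : exists p : nat, 2 ^- p < e :> R.
    exists (Num.trunc e^-1).+1; rewrite invf_plt ?posrE ?exprn_gt0//.
    apply: (lt_le_trans (truncnS_gt _)); rewrite -natrX ler_nat.
    exact/ltnW/ltn_expl.
  exists p => y yx; apply: xU; rewrite ballEmdist/=; apply: le_lt_trans pe.
  rewrite /mdist/= /shift_dist; case: eqP => [_|/eqP xy].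
    by rewrite invr_ge0 exprn_ge0.
  rewrite lef_pV2 ?posrE ?exprn_gt0// ler_eXn2l ?ltr1n//.
  have [[j xyj <-] _] := nat_minP (diff_abs_neq0 xy).
  by rewrite leqNgt; apply/negP => jp; apply: xyj; rewrite yx//; lia.
apply/(@nbhs_ballP R); exists (2 ^- p) => /=; first by rewrite invr_gt0 exprn_gt0.
move=> y; rewrite ballEmdist/= => xy; apply: xU => i ip.
apply: contrapT => yx; have /shift_dist_le : x i <> y i by move/esym.
apply/negP; rewrite -ltNge; apply: (lt_le_trans xy).
by rewrite lef_pV2 ?posrE ?exprn_gt0// ler_eXn2l ?ltr1n//; lia.
Qed.

Definition has_radius (r : nat) F : Prop := forall x y (j : int),
  (forall i : int, j - r%:Z <= i <= j + r%:Z -> x i = y i) -> F x j = F y j.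

Definition translate (k : int) x : fullshift R A := fun i => x (i + k).

Lemma translateK k x : translate k (translate (- k) x) = x.
Proof. by apply/funext => i; rewrite /translate addrK. Qed.

Lemma translateNK k x : translate (- k) (translate k x) = x.
Proof. by apply/funext => i; rewrite /translate subrK. Qed.

Lemma ca_translate F k x : cellular_automaton F ->
  F (translate k x) = translate k (F x).
Proof.
move=> [_ Fs].
have pos (n : nat) z : F (translate n z) = translate n (F z).
  elim: n z => [|n IH] z.
    by have tr0 u : translate 0%:Z u = u;
      [apply/funext => i; rewrite /translate addr0|rewrite !tr0].
  have trS u : translate n.+1 u = shift_map (translate n u).
    by apply/funext => i; rewrite /translate /shift_map; congr (u _); lia.
  by rewrite !trS Fs IH.
have [n [->|->]] : exists n : nat, k = n%:Z \/ k = - n%:Z.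
  by exists `|k|%N; lia.
  exact: pos.
by rewrite -[in RHS](translateK n x) pos translateNK.
Qed.

(** Compactness of the full shift. If no radius worked, there would be pairs
    agreeing on larger and larger windows and separated by [F] at 0; the limit of
    their first components along an ultrafilter, which exists letter by letter
    because the alphabet is finite, contradicts continuity. *)
Lemma ca_local_rule F : cellular_automaton F -> exists r, has_radius r F.
Proof.
move=> Fca; have [Fc _] := Fca.
suff [r Fr] : exists r : nat, forall x y,
    (forall i : int, - r%:Z <= i <= r%:Z -> x i = y i) -> F x 0 = F y 0.
  exists r => x y j xy.
  have := Fr (translate j x) (translate j y); rewrite !ca_translate//.
  rewrite /translate !add0r; apply => i ir; apply: xy; lia.
apply: contrapT => /forallNP bad.
have {bad} bad r : exists u : fullshift R A * fullshift R A,
    (forall i : int, - r%:Z <= i <= r%:Z -> u.1 i = u.2 i) /\ F u.1 0 <> F u.2 0.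
  have /existsNP[x /existsNP[y /not_implyP[xy Fxy]]] := bad r.
  by exists (x, y).
have {bad} [u uP] := choice bad.
have [U [UU sU]] := ultraFilterLemma (eventually_filter).
have cvgA (i : int) : exists a, U [set n | (u n).1 i = a].
  apply: contrapT => /forallNP no.
  have : U [set n | forall a, (u n).1 i <> a].
    apply: filter_forall => a.
    by have [/(no a)|] := in_ultra_setVsetC [set n | (u n).1 i = a] UU.
  by move=> /filter_ex[n /(_ ((u n).1 i))].
have {cvgA} [x xP] : exists x : fullshift R A,
    forall i, U [set n | (u n).1 i = x i].
  by have [x xP] := choice cvgA; exists x.
have : nbhs x [set y | F y 0 = F x 0].
  apply: (Fc x [set y : fullshift R A | y 0 = F x 0]); apply/nbhs_fullshift; exists 0%N => y yx /=.
  by apply: yx; lia.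
move=> /nbhs_fullshift[p xp].
have near : U [set n | forall k : 'I_(p + p).+1,
    (u n).1 (k%:Z - p%:Z) = x (k%:Z - p%:Z)].
  by apply: filter_forall => k; exact: xP.
have Up : U [set n | (p <= n)%N] by apply: sU; exists p.
have [n [/= nearn pn]] := filter_ex (filterI near Up).
have [u12 []] := uP n.
have ux (i : int) : - p%:Z <= i <= p%:Z -> (u n).1 i = x i.
  move=> ip; have ltp : (absz (i + p%:Z)%R < (p + p).+1)%N by lia.
  by have := nearn (Ordinal ltp); have -> : (Ordinal ltp)%:Z - p%:Z = i by rewrite /=; lia.
rewrite (xp (u n).1 ux) xp// => i ip; rewrite -u12 ?ux//; lia.
Qed.

Lemma iter_translate F n k x : cellular_automaton F ->
  iter n F (translate k x) = translate k (iter n F x).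
Proof. by move=> Fca; elim: n => //= n ->; rewrite ca_translate. Qed.

Lemma iter_radius r F n : has_radius r F -> has_radius (n * r) (iter n F).
Proof.
move=> Fr; elim: n => [|n IH] x y j xy /=; first by apply: xy; lia.
by apply: Fr => i ij; apply: IH => k ki; apply: xy; lia.
Qed.

(** Both exponents are treated at once, up to the reflection of the line: [true]
    stands for [Iminus], with disturbances coming from the right, and [false] for
    [Iplus], with disturbances coming from the left. *)
Definition dir (b : bool) (i : int) : int := if b then i else - i.

(** The range of times starts at 0, where the condition holds because [s] is
    nonnegative, so that orbits can be compared from their starting points. *)
Definition safe_dist b F n x (s : nat) : Prop :=
  forall y, (forall i, dir b i <= s%:Z -> y i = x i) ->
  forall m, (m <= n)%N -> forall j, dir b j <= 0 -> iter m F y j = iter m F x j.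

Definition exponent b F n x : nat := nat_min (safe_dist b F n x).

Lemma Iminus_exponent F n x : Iminus F n x = exponent true F n x.
Proof.
congr nat_min; apply/seteqP; split=> s /= safe.
  move=> y yx [|m] mn j j0; first by apply: yx; rewrite /dir in j0 *; lia.
  by apply: (safe m.+1 mn); [exists y|exact: j0].
by move=> m /andP[_ mn] _ [y yx <-] j j0; exact: (safe y yx m mn j j0).
Qed.

Lemma Iplus_exponent F n x : Iplus F n x = exponent false F n x.
Proof.
congr nat_min; apply/seteqP; split=> s /= safe.
  move=> y yx [|m] mn j; rewrite /dir => j0; first by apply: yx; rewrite /dir; lia.
  apply: (safe m.+1 mn); last by lia.
  by exists y => // i si; apply: yx; rewrite /dir; lia.
move=> m /andP[_ mn] _ [y yx <-] j j0; apply: (safe y _ m mn j).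
  by move=> i; rewrite /dir => si; apply: yx; lia.
by rewrite /dir; lia.
Qed.

Lemma safe_dist_radius r b F n x : has_radius r F -> safe_dist b F n x (n * r).
Proof.
move=> Fr y yx m mn j j0; apply: (iter_radius (n := m) Fr) => i ij; apply: yx.
have : (m * r <= n * r)%N by rewrite leq_mul2r mn orbT.
by move: ij j0; rewrite /dir; case: b; lia.
Qed.

Lemma exponent_safe r b F n x : has_radius r F ->
  safe_dist b F n x (exponent b F n x).
Proof.
move=> Fr; suff /nat_minP[] : safe_dist b F n x !=set0 by [].
by exists (n * r)%N; exact: safe_dist_radius.
Qed.

Lemma exponent_le b F n x s : safe_dist b F n x s -> (exponent b F n x <= s)%N.
Proof.
by move=> safe; have /nat_minP[_] : safe_dist b F n x !=set0 by [exists s]; apply.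
Qed.

Lemma safe_dist_mono b F n x s t : (s <= t)%N ->
  safe_dist b F n x s -> safe_dist b F n x t.
Proof. by move=> st safe y yx; apply: safe => i si; apply: yx; lia. Qed.

Lemma exponent_translate_safe r b F n p x y m j :
  cellular_automaton F -> has_radius r F ->
  (forall i, dir b i <= p%:Z + (exponent b F n (translate (dir b p%:Z) x))%:Z ->
    y i = x i) ->
  (m <= n)%N -> dir b j <= p%:Z -> iter m F y j = iter m F x j.
Proof.
move=> Fca Fr yx mn jp.
have := exponent_safe (b := b) (n := n) (x := translate (dir b p%:Z) x) Fr.
set s := exponent b F n _ in yx * => safe.
have := safe (translate (dir b p%:Z) y) _ m mn (j - dir b p%:Z).
rewrite !iter_translate// /translate subrK; apply.
  by move=> i si; apply: yx; rewrite /dir in si *; case: (b) si => si; lia.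
by rewrite /dir in jp *; case: (b) jp => jp; lia.
Qed.

(** Orbits [w] and [z] agreeing on the window at all times can be glued: if [y]
    starts as [w] on the right and as [z] on the left, it keeps doing so. Near
    the left edge of the window the value of [y] is computed from the left part,
    where it is that of [z], which is that of [w] in the window; the window being
    at least two radii wide, each coordinate is far enough from one edge. *)
Lemma orbit_gluing r F p n y w z : has_radius r F -> (r <= p)%N ->
  (forall j, - p%:Z <= j -> y j = w j) ->
  (forall j, j <= p%:Z -> y j = z j) ->
  (forall i, (i <= n)%N ->
    forall j, - p%:Z <= j <= p%:Z -> iter i F w j = iter i F z j) ->
  forall i, (i <= n)%N ->
    (forall j, - p%:Z <= j -> iter i F y j = iter i F w j) /\
    (forall j, j <= p%:Z -> iter i F y j = iter i F z j).
Proof.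
move=> Fr rp yw yz wz; elim=> [//|i IH] lt_in.
have [IHw IHz] := IH (ltnW lt_in).
have stepw j : - p%:Z + r%:Z <= j -> iter i.+1 F y j = iter i.+1 F w j.
  by move=> pj; apply: Fr => k kj; apply: IHw; lia.
have stepz j : j <= p%:Z - r%:Z -> iter i.+1 F y j = iter i.+1 F z j.
  by move=> pj; apply: Fr => k kj; apply: IHz; lia.
split=> j pj.
  have [/stepw//|jp] := leP (- p%:Z + r%:Z) j.
  by rewrite (wz _ lt_in) ?stepz//; lia.
have [/stepz//|jp] := leP j (p%:Z - r%:Z).
by rewrite -(wz _ lt_in) ?stepw//; lia.
Qed.

(** The exponent at the edge of the window, with the letters from the opposite
    edge up to that distance beyond; it is padded so as to live in a finite type,
    the exponent being at most [n * r]. *)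
Definition side_word r b F n p x :
    'I_(n * r).+1 * {ffun 'I_((p + p).+1 + n * r) -> A} :=
  let s := exponent b F n (translate (dir b p%:Z) x) in
  (inord s, [ffun i : 'I_((p + p).+1 + n * r) =>
    if (i < (p + p).+1 + s)%N then x (dir b (i%:Z - p%:Z)) else point]).

Lemma side_word_fst r b F n p x : has_radius r F ->
  (side_word r b F n p x).1 = exponent b F n (translate (dir b p%:Z) x) :> nat.
Proof.
move=> Fr; rewrite inordK// ltnS; apply: exponent_le.
exact: safe_dist_radius.
Qed.

Lemma side_word_eq r b F n p x y : has_radius r F ->
  side_word r b F n p x = side_word r b F n p y ->
  forall i, - p%:Z <= dir b i <=
    p%:Z + (exponent b F n (translate (dir b p%:Z) x))%:Z -> x i = y i.
Proof.
move=> Fr xy i; set s := exponent b F n _ => ip.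
have sx := side_word_fst b n p x Fr.
have sy := side_word_fst b n p y Fr; rewrite -xy sx in sy.
have sn : (s <= n * r)%N by apply: exponent_le; exact: safe_dist_radius.
have lti : (absz (dir b i + p%:Z)%R < (p + p).+1 + n * r)%N by lia.
move/(congr1 snd): xy => /ffunP/(_ (Ordinal lti)); rewrite !ffunE/= -sy -/s.
have -> : (absz (dir b i + p%:Z)%R < (p + p).+1 + s)%N by lia.
have -> : dir b ((absz (dir b i + p%:Z)%R)%:Z - p%:Z) = i.
  by rewrite /dir in ip *; case: (b) ip => ip; lia.
by [].
Qed.

(** Let [w] coincide with [x] up to [p] and with [y] beyond. The first word makes
    the orbit of [w] coincide with that of [x] up to [p] during [m] steps. It
    remains to show that the orbits of [y] and [w] coincide from [-p] on, which
    goes block by block: at time [k * n], gluing [F^(kn) x] on the right to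
    [F^(kn) y] on the left gives [z], whose orbit is that of [F^(kn) x] from [-p]
    on, hence agrees with that of [w] on the window; so the orbits of [w] and [z]
    can be glued into that of [y]. *)
Lemma side_words_determine_column r F n m p x y :
  cellular_automaton F -> has_radius r F -> (r <= p)%N -> (0 < n)%N ->
  side_word r true F m p x = side_word r true F m p y ->
  (forall k, (k * n <= m)%N ->
    side_word r false F n p (iter (k * n) F x) =
    side_word r false F n p (iter (k * n) F y)) ->
  forall t, (t <= m)%N -> forall j, - p%:Z <= j <= p%:Z ->
    iter t F x j = iter t F y j.
Proof.
move=> Fca Fr rp n0 xy0 xyk.
have {}xy0 := side_word_eq Fr xy0; rewrite /dir in xy0.
pose w : fullshift R A := fun i => if i <= p%:Z then x i else y i.
have wx t j : (t <= m)%N -> j <= p%:Z -> iter t F w j = iter t F x j.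
  move=> tm jp; apply: (@exponent_translate_safe r true F m p) => // i.
  rewrite /dir /w => ip; case: ifP => // /negbT; rewrite -ltNge => pi.
  by rewrite xy0//; lia.
pose glued k := forall j, - p%:Z <= j -> iter (k * n) F y j = iter (k * n) F w j.
have block k i : (k * n + i <= m)%N -> (i <= n)%N -> glued k ->
    forall j, - p%:Z <= j -> iter (k * n + i) F y j = iter (k * n + i) F w j.
  move=> kim lein gk j pj.
  have xykn := side_word_eq Fr (xyk k (leq_trans (leq_addr _ _) kim)).
  rewrite /dir in xykn; rewrite ![(k * n + i)%N]addnC !iterD.
  set xk := iter (k * n) F x in xykn *; set yk := iter (k * n) F y in xykn *.
  pose z : fullshift R A := fun i => if - p%:Z <= i then xk i else yk i.
  have zx t l : (t <= n)%N -> - p%:Z <= l -> iter t F z l = iter t F xk l.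
    move=> tn lp; apply: (@exponent_translate_safe r false F n p) => //.
      move=> l'; rewrite /dir /z => lp'; case: ifP => // /negbT pl'.
      by rewrite xykn//; lia.
    by rewrite /dir; lia.
  have [] := @orbit_gluing r F p i yk (iter (k * n) F w) z Fr rp _ _ _ i (leqnn i).
  - exact: gk.
  - by move=> l lp; rewrite /z; case: ifP => // pl; rewrite xykn//; lia.
  - move=> t ti l /andP[pl lp]; rewrite -iterD wx//.
      by rewrite zx// 1?iterD// (leq_trans ti).
    by rewrite addnC (leq_trans _ kim)// leq_add2l.
  by move=> + _; apply.
have gluedP k : (k * n <= m)%N -> glued k.
  elim: k => [_ j pj|k IH km].
    rewrite mul0n /= /w; case: ifP => // jp; rewrite xy0//; lia.
  move=> j pj; rewrite mulSn addnC; apply: block => //.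
    by rewrite addnC -mulSn.
  by apply: IH; apply: leq_trans km; rewrite mulSn leq_addl.
move=> t tm j /andP[pj jp]; rewrite -(wx t j tm jp) (divn_eq t n).
symmetry; apply: block => //; first by rewrite -divn_eq.
  by rewrite ltnW// ltn_mod.
by apply: gluedP; apply: leq_trans tm; rewrite leq_divM.
Qed.

End symbolic.

(** * Mean exponents bound the entropy of itineraries *)

Section measure.
Context {R : realType} {A : finPointedType}.
Implicit Types (x y z : fullshift R A) (F T : fullshift R A -> fullshift R A).
Local Notation X := (borel_fullshift R A).

Definition local_map (T : Type) (p : nat) (f : X -> T) : Prop :=
  forall x y, (forall i : int, - p%:Z <= i <= p%:Z -> x i = y i) -> f x = f y.

Lemma local_map_mono (T : Type) p q (f : X -> T) : (p <= q)%N ->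
  local_map p f -> local_map q f.
Proof. by move=> pq fp x y xy; apply: fp => i ip; apply: xy; lia. Qed.

Lemma open_measurable_fullshift (U : set X) :
  open (U : set (fullshift R A)) -> measurable U.
Proof. exact: sub_sigma_algebra. Qed.

Lemma local_measurable p (C : set X) : local_map p C -> measurable C.
Proof.
move=> Cp; apply: open_measurable_fullshift; rewrite openE => x Cx.
by apply/nbhs_fullshift; exists p => y yx; rewrite (Cp y x).
Qed.

Lemma fin_meas_local (T : finType) (f : X -> T) (p : nat) :
  local_map p f -> fin_meas f.
Proof.
move=> fp t; apply: (@local_measurable p) => x y xy.
by rewrite /preimage/= (fp x y).
Qed.

Lemma radius_measurable r T : has_radius r T ->
  forall B : set X, measurable B -> measurable ((T : X -> X) @^-1` B).
Proof.
move=> Tr B; pose G := [set B : set X | measurable ((T : X -> X) @^-1` B)].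
have sG : sigma_algebra setT G.
  split=> [|C mC|C mC]; rewrite /G/=.
  - by rewrite preimage_set0.
  - by rewrite setTD -preimage_setC; exact: measurableC.
  - by rewrite preimage_bigcup; exact: bigcupT_measurable.
apply: (smallest_sub sG) => U oU; apply: open_measurable_fullshift.
rewrite openE => x Ux; move: oU; rewrite openE => /(_ _ Ux).
rewrite /interior => /nbhs_fullshift[p xp]; apply/nbhs_fullshift.
exists (p + r)%N => y yx; apply: xp => i ip; apply: Tr => j ji; apply: yx; lia.
Qed.

Lemma translate_radius (k : int) :
  has_radius `|k|%N (translate k : fullshift R A -> fullshift R A).
Proof. by move=> x y j xy; apply: xy; lia. Qed.

Variable mu : probability X R.

Lemma invariant_translate (k : int) :
  invariant_measure mu (shift_map : X -> X) ->
  invariant_measure mu (translate k : X -> X).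
Proof.
move=> mus.
have shift_radius : has_radius 1 (shift_map : fullshift R A -> _).
  by move=> x y j xy; apply: xy; lia.
have pos (n : nat) : invariant_measure mu (translate n%:Z : X -> X).
  have -> : translate n%:Z = iter n shift_map :> (fullshift R A -> fullshift R A).
    apply/funext => x; elim: n => [|n IH]; apply/funext => i.
      by rewrite /translate addr0.
    by rewrite iterS -IH /translate /shift_map; congr (x _); lia.
  exact: invariant_measure_iter (radius_measurable shift_radius) mus.
have [n [->|->]] : exists n : nat, k = n%:Z \/ k = - n%:Z.
  by exists `|k|%N; lia.
  exact: pos.
move=> B mB; rewrite -(pos n); last exact: radius_measurable (@translate_radius _) _ mB.
by congr (mu _); apply/seteqP; split=> x /=; rewrite translateNK.
Qed.

(** The set is closed: a disturbance witnessing that [s] is not safe for [x], at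
    some time and some coordinate, does so for each configuration close to [x]. *)
Lemma safe_dist_measurable r b F n s : has_radius r F ->
  measurable ([set x | safe_dist b F n x s] : set X).
Proof.
move=> Fr; rewrite -[X in measurable X]setCK; apply: measurableC.
apply: open_measurable_fullshift; rewrite openE => x /= unsafe.
have {unsafe} [y [yx [m [mn [j [j0 yxj]]]]]] : exists y,
    (forall i, dir b i <= s%:Z -> y i = x i) /\ exists m, (m <= n)%N /\
    exists j, dir b j <= 0 /\ iter m F y j <> iter m F x j.
  apply: contrapT => no; apply: unsafe => y yx m mn j j0.
  apply: contrapT => yxj; apply: no; exists y; split=> //.
  by exists m; split=> //; exists j.
apply/nbhs_fullshift; exists (`|j| + m * r)%N => x' x'x safe.
(* The same disturbance, transplanted onto [x']. *)
pose y' : fullshift R A := fun i => if dir b i <= s%:Z then x' i else y i.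
have /safe/(_ m mn j j0) : forall i, dir b i <= s%:Z -> y' i = x' i.
  by move=> i si; rewrite /y' si.
have -> : iter m F y' j = iter m F y j.
  apply: (iter_radius (n := m) Fr) => i ij.
  by rewrite /y'; case: ifP => // si; rewrite yx// x'x//; lia.
have -> : iter m F x' j = iter m F x j.
  by apply: (iter_radius (n := m) Fr) => i ij; rewrite x'x//; lia.
exact: yxj.
Qed.

Lemma fin_meas_exponent r b F n : has_radius r F ->
  fin_meas (fun x : X => inord (exponent b F n x) : 'I_(n * r).+1).
Proof.
move=> Fr t.
have mle s : measurable ([set x | (exponent b F n x <= s)%N] : set X).
  have := @safe_dist_measurable r b F n s Fr; congr (measurable _).
  apply/seteqP; split=> x /=; first exact: exponent_le.
  by move=> /safe_dist_mono; apply; exact: exponent_safe Fr.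
have -> : (fun x : X => inord (exponent b F n x) : 'I_(n * r).+1) @^-1` [set t] =
    [set x | (exponent b F n x <= t)%N] `\`
    (if (0 < t)%N then [set x | (exponent b F n x <= t.-1)%N] else set0).
  have le x : (exponent b F n x <= n * r)%N.
    exact/exponent_le/safe_dist_radius.
  apply/seteqP; split=> x /=.
    move=> /(congr1 val); rewrite /= inordK ?ltnS// => et; split; first by rewrite et.
    by case: ifP => //= t0; lia.
  move=> [et te]; apply: val_inj; rewrite /= inordK ?ltnS//.
  by move: te; case: ifP => //= t0; lia.
by apply: measurableD => //; case: ifP.
Qed.

Definition mean_exponent b F n : R :=
  fine (\int[mu]_x (exponent b F n x)%:R%:E).

Lemma mean_exponentE r b F n : has_radius r F ->
  mean_exponent b F n = \sum_l law mu
    (fun x : X => inord (exponent b F n x) : 'I_(n * r).+1) l * l%:R /\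
  (\int[mu]_x (exponent b F n x)%:R%:E = (mean_exponent b F n)%:E)%E.
Proof.
move=> Fr; have := integral_fin_meas mu (h := fun l : 'I_(n * r).+1 => l%:R : R)
  (@fin_meas_exponent r b F n Fr) (fun=> ler0n _ _).
under eq_integral => x _.
  rewrite inordK; last by rewrite ltnS; exact/exponent_le/safe_dist_radius.
  over.
by move=> intE; rewrite /mean_exponent intE.
Qed.

Lemma fin_meas_side_word r b F n p : has_radius r F ->
  fin_meas (side_word r b F n p : X -> _).
Proof.
move=> Fr; have me : fin_meas ((fun x : X =>
    inord (exponent b F n x) : 'I_(n * r).+1) \o (translate (dir b p%:Z) : X -> X)).
  apply: fin_meas_measurable_comp (@fin_meas_exponent r b F n Fr).
  exact: radius_measurable (@translate_radius _).
have mw : fin_meas (fun x : X => [ffun i : 'I_((p + p).+1 + n * r) =>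
    x (dir b (i%:Z - p%:Z))]).
  apply: (@fin_meas_local _ _ ((p + p).+1 + n * r + p)) => x y xy.
  apply/ffunP => i; rewrite !ffunE; apply: xy.
  by have := ltn_ord i; rewrite /dir; case: b {me}; lia.
apply: fin_meas_determined (fin_meas_pair me mw) _ => x y [/= exy wxy].
have {}exy : exponent b F n (translate (dir b p%:Z) x) =
    exponent b F n (translate (dir b p%:Z) y).
  move/(congr1 val): exy; rewrite /= !inordK// ltnS;
    exact/exponent_le/safe_dist_radius.
rewrite /side_word exy; congr (_, _); apply/ffunP => i.
by move/ffunP: wxy => /(_ i); rewrite !ffunE => ->.
Qed.

Lemma shannon_side_word r b F n p : has_radius r F ->
  invariant_measure mu (shift_map : X -> X) ->
  shannon mu (side_word r b F n p : X -> _) <=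
  ((p + p).+2%:R + mean_exponent b F n) * ln (2 * #|A|%:R).
Proof.
move=> Fr mus; have [-> _] := @mean_exponentE r b F n Fr.
rewrite -(law_invariant (invariant_translate (dir b p%:Z) mus) (@fin_meas_exponent r b F n Fr)).
apply: (@shannon_padded_word _ _ _ mu A point); first exact: fin_meas_side_word.
move=> x i; rewrite side_word_fst// /side_word ffunE /= leqNgt.
by move=> /negPf ->.
Qed.

(** The label [lbl] is recovered from the window of [x] through [q], except where
    the two differ; the function in the last term lists these corrections. The
    left side is controlled anew in each of the [m %/ n + 1] blocks of [n] steps,
    the right side once for [m] steps, so that [n] and [m] can be chosen
    separately. *)
Lemma shannon_itinerary_exponents r F n m p (k : nat) (lbl q : X -> 'I_k) :
  cellular_automaton F -> has_radius r F -> (r <= p)%N -> (0 < n)%N ->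
  invariant_measure mu (shift_map : X -> X) ->
  invariant_measure mu (F : X -> X) ->
  fin_meas lbl ->
  local_map p q ->
  shannon mu (itinerary (F : X -> X) lbl m) <=
    ((p + p).+2%:R + mean_exponent true F m) * ln (2 * #|A|%:R) +
    (m %/ n).+1%:R *
      (((p + p).+2%:R + mean_exponent false F n) * ln (2 * #|A|%:R)) +
    m%:R * shannon mu (fun x : X => if lbl x == q x then None else Some (lbl x)).
Proof.
move=> Fca Fr rp n0 mus muF mlbl qp.
pose e (x : X) := if lbl x == q x then None else Some (lbl x).
have mF i B : measurable B -> measurable ((iter i F : X -> X) @^-1` B).
  exact: measurable_iter (radius_measurable Fr) B.
have me : fin_meas e.
  apply: fin_meas_determined (fin_meas_pair mlbl (fin_meas_local qp)) _.
  by move=> x y [exy qxy]; rewrite /e exy qxy.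
pose past : X -> _ := side_word r true F m p.
pose blocks (x : X) := [ffun j : 'I_(m %/ n).+1 => side_word r false F n p (iter (j * n) F x)].
pose errors (x : X) := [ffun i : 'I_m => e (iter i F x)].
have mpast : fin_meas past by exact: fin_meas_side_word.
have mblock j : fin_meas (fun x : X => side_word r false F n p (iter (j * n) F x)).
  exact: fin_meas_measurable_comp (mF _) (@fin_meas_side_word r false F n p Fr).
have merror i : fin_meas (fun x : X => e (iter i F x)).
  exact: fin_meas_measurable_comp (mF _) me.
have mblocks : fin_meas blocks by apply: fin_meas_ffun => j; exact: mblock.
have merrors : fin_meas errors by apply: fin_meas_ffun => i; exact: merror.
apply: (@le_trans _ _ (shannon mu (fun x => ((past x, blocks x), errors x)))).
  apply: shannon_determined.
    exact: fin_meas_pair (fin_meas_pair mpast mblocks) merrors.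
  move=> x y xy.
  have pxy : past x = past y := congr1 (fun u => u.1.1) xy.
  have bxy : blocks x = blocks y := congr1 (fun u => u.1.2) xy.
  have exy : errors x = errors y := congr1 snd xy.
  apply/ffunP => i; rewrite !ffunE.
  move/ffunP: exy => /(_ i); rewrite !ffunE /e.
  (* The words determine the window, hence [q]; the corrections give [lbl]. *)
  have -> : q (iter i F x) = q (iter i F y).
    apply: qp; apply: (side_words_determine_column Fca Fr rp n0 pxy) => //.
      move=> j jm; have jn : (j < (m %/ n).+1)%N by rewrite ltnS leq_divRL.
      by move/ffunP: bxy => /(_ (Ordinal jn)); rewrite !ffunE.
    exact: ltnW.
  by do 2 case: eqP => [->|_]; do ?case.
apply: le_trans (shannon_pair mu (fin_meas_pair mpast mblocks) merrors) _.
apply: lerD.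
  apply: le_trans (shannon_pair mu mpast mblocks) _; apply: lerD.
    exact: shannon_side_word.
  apply: le_trans (shannon_ffun mu (fun j => mblock j)) _.
  rewrite mulr_natl -[X in _ *+ X]card_ord -sumr_const; apply: ler_sum => j _.
  rewrite (shannon_invariant (invariant_measure_iter (j * n) (radius_measurable Fr) muF) (@fin_meas_side_word r false F n p Fr)).
  exact: shannon_side_word.
apply: le_trans (shannon_ffun mu (fun i => merror i)) _.
rewrite mulr_natl -[X in _ *+ X]card_ord -sumr_const; apply: ler_sum => i _.
by rewrite (shannon_invariant (invariant_measure_iter i (radius_measurable Fr) muF) me).
Qed.

End measure.

(** * Approximation of measurable labels by local ones *)

Section symdiff_measure.
Context {d : measure_display} {X : measurableType d} {R : realType}.
Variable mu : probability X R.

Definition symdiff (B C : set X) : set X := (B `\` C) `|` (C `\` B).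

Lemma measurable_symdiff B C :
  measurable B -> measurable C -> measurable (symdiff B C).
Proof. by move=> mB mC; apply: measurableU; exact: measurableD. Qed.

Lemma fine_muU_le B C : measurable B -> measurable C ->
  fine (mu (B `|` C)) <= fine (mu B) + fine (mu C).
Proof.
move=> mB mC; rewrite -lee_fin EFinD !fine_muE//; last exact: measurableU.
exact: measureU2.
Qed.

Lemma fine_mu_bigcup_le (I : finType) (D : I -> set X) :
  (forall i, measurable (D i)) ->
  fine (mu (\bigcup_i D i)) <= \sum_i fine (mu (D i)).
Proof.
move=> mD; have -> : \bigcup_i D i = \bigcup_(i in [set` index_enum I]) D i.
  by congr (\bigcup_(_ in _) _); apply/seteqP; split=> // i _ /=; rewrite mem_index_enum.
elim: (index_enum I) => [|i s IH].
  by rewrite big_nil set_nil bigcup_set0 measure0.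
have mU : measurable (\bigcup_(j in [set` s]) D j).
  by apply: fin_bigcup_measurable => // j _; exact: mD.
have -> : \bigcup_(j in [set` i :: s]) D j = D i `|` \bigcup_(j in [set` s]) D j.
  apply/seteqP; split=> [x [j /=]|x [Dx|[j js Dx]]].
  - by rewrite inE => /predU1P[->|js] Dx; [left|right; exists j].
  - by exists i; rewrite //= inE eqxx.
  - by exists j; rewrite //= inE; apply/orP; right.
rewrite big_cons.
by apply: le_trans (fine_muU_le (mD i) mU) _; rewrite lerD2l.
Qed.

Lemma fine_mu_tail (B : (set X)^nat) (e : R) : 0 < e ->
  (forall n, measurable (B n)) -> nondecreasing_seq B ->
  exists n, fine (mu ((\bigcup_k B k) `\` B n)) <= e.
Proof.
move=> e0 mB Bnd; have mU : measurable (\bigcup_k B k) by exact: bigcupT_measurable.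
have : fine \o (mu \o B) @ \oo --> fine (mu (\bigcup_k B k)).
  by apply: fine_cvg; rewrite fine_muE//; exact: nondecreasing_cvg_mu.
move=> /(@cvgrPdist_le R R^o)/(_ e e0)[n _ /(_ n (leqnn n)) /= Bn]; exists n.
have BU : B n `<=` \bigcup_k B k by move=> x Bx; exists n.
have : mu (\bigcup_k B k) = (mu (B n) + mu ((\bigcup_k B k) `\` B n))%E.
  rewrite -measureU ?setDUK//; first exact: measurableD.
  by apply/seteqP; split=> // x [? []].
move=> /(congr1 fine); rewrite fineD ?fin_num_measure//; last exact: measurableD.
by move: Bn; rewrite ler_norml; lra.
Qed.

End symdiff_measure.

Section cylinder_approximation.
Context {R : realType} {A : finPointedType}.
Local Notation X := (borel_fullshift R A).
Variable mu : probability X R.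

Definition cylinder_approximable (B : set X) : Prop :=
  measurable B /\ forall e : R, 0 < e ->
    exists p C, local_map p C /\ fine (mu (symdiff B C)) <= e.

Lemma local_approximable p (C : set X) : local_map p C -> cylinder_approximable C.
Proof.
move=> Cp; split=> [|e e0]; first exact: local_measurable Cp.
by exists p, C; split=> //; rewrite /symdiff setDv setU0 measure0 ltW.
Qed.

Lemma approximableC B : cylinder_approximable B -> cylinder_approximable (~` B).
Proof.
move=> [mB Ba]; split=> [|e /Ba[p [C [Cp BC]]]]; first exact: measurableC.
exists p, (~` C); split; first by move=> x y xy; rewrite /setC/= (Cp x y xy).
suff -> : symdiff (~` B) (~` C) = symdiff B C by [].
by rewrite /symdiff !setDE !setCK setUC [~` C `&` _]setIC [~` B `&` _]setIC.
Qed.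

Lemma approximableU B B' : cylinder_approximable B -> cylinder_approximable B' ->
  cylinder_approximable (B `|` B').
Proof.
move=> [mB Ba] [mB' Ba']; split=> [|e e0]; first exact: measurableU.
have e20 : 0 < e / 2 by rewrite divr_gt0.
have [p [C [Cp BC]]] := Ba _ e20; have [p' [C' [Cp' BC']]] := Ba' _ e20.
exists (maxn p p'), (C `|` C'); split.
  move=> x y xy; rewrite /setU/= (local_map_mono (leq_maxl p p') Cp xy).
  by rewrite (local_map_mono (leq_maxr p p') Cp' xy).
have mC := local_measurable Cp; have mC' := local_measurable Cp'.
rewrite (splitr e); apply: le_trans (lerD BC BC').
apply: le_trans (fine_muU_le mu _ _); try exact: measurable_symdiff.
apply: fine_mu_le; try by apply: measurable_symdiff; exact: measurableU.
  by apply: measurableU; exact: measurable_symdiff.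
by rewrite /symdiff => x /=; tauto.
Qed.

Lemma approximable_bigcup (B : (set X)^nat) :
  (forall n, cylinder_approximable (B n)) -> cylinder_approximable (\bigcup_n B n).
Proof.
move=> Ba; pose S n := \big[setU/set0]_(i < n.+1) B i.
have Sa n : cylinder_approximable (S n).
  elim: n => [|n IH]; rewrite /S big_ord_recr/=; last exact: approximableU.
  by rewrite big_ord0 set0U.
have mB : measurable (\bigcup_n B n).
  by apply: bigcupT_measurable => n; have [] := Ba n.
have SB : \bigcup_n S n = \bigcup_n B n by rewrite bigcup_bigsetU_bigcup.
split=> // e e0; have e20 : 0 < e / 2 by rewrite divr_gt0.
have [n] : exists n, fine (mu ((\bigcup_k S k) `\` S n)) <= e / 2.
  apply: fine_mu_tail => // [n|m n mn]; first by have [] := Sa n.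
  by apply/subsetPset; exact: subset_bigsetU.
have [mS /(_ _ e20)[p [C [Cp SC]]]] := Sa n; rewrite SB => BS.
have mC := local_measurable Cp.
exists p, C; split=> //; rewrite (splitr e); apply: le_trans (lerD BS SC).
apply: le_trans (fine_muU_le mu _ _).
- apply: fine_mu_le; first exact: measurable_symdiff.
    by apply: measurableU; [exact: measurableD|exact: measurable_symdiff].
  have SnB : S n `<=` \bigcup_k B k by rewrite -SB => x Sx; exists n.
  rewrite /symdiff => x /= -[[Bx nCx]|[Cx nBx]].
    by have [Sx|nSx] := pselect (S n x); [right; left|left].
  by right; right; split=> // /SnB.
- exact: measurableD.
- exact: measurable_symdiff.
Qed.

(** Approximable sets form a sigma-algebra, and an open set [U] is the union over
    [p] of the sets of points whose window of size [p] forces membership in [U],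
    which are cylinders. *)
Lemma measurable_approximable (B : set X) : measurable B -> cylinder_approximable B.
Proof.
have sG : sigma_algebra setT cylinder_approximable.
  split=> [|C Ca|C Ca]; last exact: approximable_bigcup.
    by apply: (@local_approximable 0%N) => x y.
  by rewrite setTD; exact: approximableC.
apply: (smallest_sub sG) => U oU.
pose V p : set X := [set x | forall y : fullshift R A,
  (forall i : int, - p%:Z <= i <= p%:Z -> y i = x i) -> U y].
have -> : U = \bigcup_p V p.
  apply/seteqP; split=> [x Ux|x [p _ Vx]]; last exact: Vx.
  have : nbhs (x : fullshift R A) U by apply: open_nbhs_nbhs; split.
  by move=> /nbhs_fullshift[p xp]; exists p.
apply: approximable_bigcup => p; apply: (@local_approximable p) => x y xy.
by apply/propext; split=> Vx z zy; apply: Vx => i ip; rewrite zy// xy.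
Qed.

Lemma local_label_approximation (k : nat) (lbl : X -> 'I_k) (e : R) : 0 < e ->
  fin_meas lbl ->
  exists p (q : X -> 'I_k), local_map p q /\
    fine (mu [set x | lbl x != q x]) <= e.
Proof.
move=> e0 mlbl; have k0 : 0 < k%:R :> R.
  by rewrite ltr0n; apply: leq_ltn_trans (ltn_ord (lbl point)).
have ek0 : 0 < e / k%:R by rewrite divr_gt0.
have /choice[h hP] i : exists u : nat * set X, local_map u.1 u.2 /\
    fine (mu (symdiff (lbl @^-1` [set i]) u.2)) <= e / k%:R.
  have [_ /(_ _ ek0)[p [C PC]]] := measurable_approximable (mlbl i).
  by exists (p, C).
pose p := (\max_i (h i).1)%N.
have hp i : local_map p (h i).2.
  by apply: local_map_mono (hP i).1; exact: (leq_bigmax (F := fun i => (h i).1)).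
pose q (x : X) := odflt (lbl point) [pick i | `[< (h i).2 x >]].
have qp : local_map p q.
  by move=> x y xy; rewrite /q; congr odflt; apply: eq_pick => i; rewrite (hp i x y xy).
exists p, q; split=> //.
have mh i : measurable (symdiff (lbl @^-1` [set i]) (h i).2).
  by apply: measurable_symdiff => //; exact: local_measurable (hp i).
apply: (@le_trans _ _ (fine (mu (\bigcup_i symdiff (lbl @^-1` [set i]) (h i).2)))).
  apply: fine_mu_le; last first.
  - move=> x /= lq; apply: contrapT => nD; move/negP: lq; apply.
    have hx i : (h i).2 x <-> lbl x = i.
      split=> [hx|lx]; apply: contrapT => no; apply: nD; exists i => //.
        by right.
      by left.
    rewrite /q; case: pickP => [i /asboolP/hx/eqP //|/(_ (lbl x))].
    by move=> /asboolP; case; exact/hx.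
  - by apply: fin_bigcup_measurable => // i _; exact: mh.
  have mq : fin_meas q := fin_meas_local qp.
  have := fin_meas_preimage [set u | u.1 != u.2] (fin_meas_pair mlbl mq).
  by [].
apply: le_trans (fine_mu_bigcup_le mu mh) _.
apply: (@le_trans _ _ (\sum_(i < k) e / k%:R)).
  by apply: ler_sum => i _; have [] := hP i.
by rewrite sumr_const card_ord -[X in X <= _]mulr_natr divfK// gt_eqF.
Qed.

(** Agreement up to a small measure makes the list of corrections cheap. *)
Lemma local_label_small_error (k : nat) (lbl : X -> 'I_k) (e : R) : 0 < e ->
  fin_meas lbl ->
  exists p (q : X -> 'I_k), local_map p q /\
    shannon mu (fun x : X => if lbl x == q x then None else Some (lbl x)) <= e.
Proof.
move=> e0 mlbl.
have [delta d0 small] := shannon_concentrated mu (None : option 'I_k) e0.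
have [p [q [qp lq]]] := local_label_approximation d0 mlbl.
exists p, q; split=> //.
have mq : fin_meas q := fin_meas_local qp.
set err := fun x : X => _.
have merr : fin_meas err.
  apply: fin_meas_determined (fin_meas_pair mlbl mq) _.
  by move=> x y xy; rewrite /err (congr1 fst xy : lbl x = lbl y) (congr1 snd xy : q x = q y).
apply: small => //; apply: le_trans lq.
have := law_comp mu (fun o => o != None) true merr.
rewrite (eq_bigl (fun o => o != None)); last by move=> o; rewrite /= eqb_id.
move=> <-; rewrite /law le_eqVlt; apply/orP; left; apply/eqP; congr (fine (mu _)).
by apply/seteqP; split=> x /=; rewrite /err; case: (lbl x == q x).
Qed.

End cylinder_approximation.

(** * From vanishing exponents to vanishing entropy *)

Section nonnegative_liminf.
Context {R : realType}.
Implicit Type u : (\bar R)^nat.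
Local Open Scope ereal_scope.

Lemma limn_einfE u : limn_einf u = ereal_sup (range (einfs u)).
Proof. by rewrite limn_einf_lim; apply/cvg_lim => //; exact: cvg_einfs_sup. Qed.

Lemma limn_einf_ge0 u : (forall n, 0 <= u n) -> 0 <= limn_einf u.
Proof.
move=> u0; rewrite limn_einfE; apply: (@le_trans _ _ (einfs u 0%N)).
  by apply: le_ereal_inf_tmp => _ [n _ <-].
by apply: ereal_sup_ubound; exists 0%N.
Qed.

Lemma limn_einf_eq0_frequently u (e : R) N : limn_einf u = 0 -> (0 < e)%R ->
  exists2 n, (N <= n)%N & u n < e%:E.
Proof.
rewrite limn_einfE => u0 e0.
have /ereal_inf_lt[_ [n Nn <-] une] : ereal_inf (sdrop u N) < e%:E.
  apply: (@le_lt_trans _ _ 0); last by rewrite lte_fin.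
  by rewrite -u0; apply: ereal_sup_ubound; exists N.
by exists n.
Qed.

End nonnegative_liminf.

Section entropy_rate.
Context {d : measure_display} {X : measurableType d} {R : realType}.
Variables (mu : probability X R) (T : X -> X).
Hypothesis mT : forall B, measurable B -> measurable (T @^-1` B).
Hypothesis muT : invariant_measure mu T.

Lemma fin_meas_itinerary k (lbl : X -> 'I_k) m :
  fin_meas lbl -> fin_meas (itinerary T lbl m).
Proof.
move=> mlbl; apply: fin_meas_ffun => i.
exact: fin_meas_measurable_comp (measurable_iter i mT) mlbl.
Qed.

(** An itinerary of length [M] is a prefix of the concatenation of [M %/ m + 1]
    itineraries of length [m], which all have the same law. *)
Lemma shannon_itinerary_blocks k (lbl : X -> 'I_k) m M : (0 < m)%N ->
  fin_meas lbl ->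
  shannon mu (itinerary T lbl M) <=
    (M %/ m).+1%:R * shannon mu (itinerary T lbl m).
Proof.
move=> m0 mlbl.
have mb j : fin_meas (itinerary T lbl m \o iter (j * m) T).
  apply: (@fin_meas_measurable_comp _ _ _ _ (iter (j * m) T)).
    exact: measurable_iter mT.
  exact: fin_meas_itinerary.
pose blocks x := [ffun j : 'I_(M %/ m).+1 => (itinerary T lbl m \o iter (j * m) T) x].
apply: (@le_trans _ _ (shannon mu blocks)).
  apply: shannon_determined => [|x y xy]; first by apply: fin_meas_ffun => j; exact: mb.
  apply/ffunP => i; rewrite !ffunE.
  have jlt : (i %/ m < (M %/ m).+1)%N by rewrite ltnS leq_div2r// ltnW.
  move/ffunP: xy => /(_ (Ordinal jlt)); rewrite !ffunE /=.
  have ilt : (i %% m < m)%N by rewrite ltn_mod.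
  move=> /ffunP/(_ (Ordinal ilt)); rewrite !ffunE /= -!iterD.
  by rewrite addnC -divn_eq.
apply: le_trans (shannon_ffun mu (fun j => mb j)) _.
rewrite mulr_natl -[X in _ *+ X]card_ord -sumr_const; apply: ler_sum => j _.
by rewrite (shannon_invariant (invariant_measure_iter _ mT muT) (@fin_meas_itinerary _ _ m mlbl)).
Qed.

(** By subadditivity, one time [m] with a small average bounds the averages at
    all later times, so that the sequence converges although smallness is only
    known at some times. *)
Lemma entropy_rate0 k (lbl : X -> 'I_k) : fin_meas lbl ->
  (forall e : R, 0 < e -> exists2 m, (0 < m)%N &
    shannon mu (itinerary T lbl m) <= m%:R * e) ->
  limn (fun m => m%:R^-1 * shannon mu (itinerary T lbl m)) = 0.
Proof.
move=> mlbl small; apply/cvg_lim => //; apply/(@cvgrPdist_le R R^o) => e e0.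
have [m m0 Hm] := small (e / 2) (divr_gt0 e0 (ltr0n _ 2)).
exists m => // M /= mM; rewrite sub0r normrN.
have M0 : 0 < M%:R :> R by rewrite ltr0n (leq_trans m0).
have mR0 : 0 < m%:R :> R by rewrite ltr0n.
rewrite ger0_norm; last first.
  by rewrite mulr_ge0 ?invr_ge0 ?ler0n// shannon_ge0//; exact: fin_meas_itinerary.
rewrite ler_pdivrMl//; apply: le_trans (shannon_itinerary_blocks M m0 mlbl) _.
apply: (@le_trans _ _ ((M %/ m).+1%:R * (m%:R * (e / 2)))).
  by rewrite ler_pM2l ?ltr0n.
have -> : M%:R * e = M.*2%:R * (e / 2) by rewrite -muln2 natrM; field.
rewrite mulrA -natrM ler_pM2r ?divr_gt0// ler_nat mulSn -addnn.
by rewrite leq_add// leq_divM.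
Qed.

Lemma partition_label k (P : 'I_k -> set X) : measurable_partition P ->
  exists2 lbl : X -> 'I_k, fin_meas lbl & P = fun i => lbl @^-1` [set i].
Proof.
move=> [mP tP cP].
have /choice[lbl Plbl] x : exists i, P i x.
  have : (\bigcup_i P i) x by rewrite cP.
  by move=> [i _ Pix]; exists i.
have PE : P = fun i => lbl @^-1` [set i].
  apply/funext => i; apply/seteqP; split=> x /= => [Pix|<-]; last exact: Plbl.
  by apply: (tP _ _ I I); exists x; split=> //; exact: Plbl.
by exists lbl => // i; have := mP i; rewrite PE.
Qed.

Lemma entropy_along_label k (lbl : X -> 'I_k) :
  entropy_along mu T (fun i => lbl @^-1` [set i]) =
  limn (fun m => m%:R^-1 * shannon mu (itinerary T lbl m)).
Proof.
congr (lim (_ @ \oo)); apply/funext => m; congr (_ * _).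
congr (partition_entropy mu _); apply/funext => w.
rewrite /iterated_join; apply/seteqP; split=> [x xw /=|x /= <- i _ /=].
  by apply/ffunP => i; rewrite ffunE; exact: xw.
by rewrite ffunE.
Qed.

Lemma ks_entropy0 :
  (forall k (lbl : X -> 'I_k) (e : R), fin_meas lbl -> 0 < e ->
    exists2 m, (0 < m)%N & shannon mu (itinerary T lbl m) <= m%:R * e) ->
  ks_entropy mu T = 0%E.
Proof.
move=> small.
have along0 k (P : 'I_k -> set X) : measurable_partition P -> entropy_along mu T P = 0.
  move=> /partition_label[lbl mlbl ->]; rewrite entropy_along_label.
  by apply: entropy_rate0 => // e e0; exact: small.
rewrite /ks_entropy; set S := [set e | _].
suff -> : S = [set 0%E] by rewrite ereal_sup1.
apply/seteqP; split=> [e [k [P [PP ->]]]|_ ->]; first by rewrite /= along0.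
have trivial_partition : measurable_partition (fun _ : 'I_1 => @setT X).
  split=> // [i j _ _ _|]; first by rewrite !ord1.
  by apply/seteqP; split=> // x _; exists ord0.
by exists 1%N, (fun=> setT); rewrite along0.
Qed.

End entropy_rate.

Section vanishing.
Context {R : realType} {A : finPointedType}.
Variables (F : fullshift R A -> fullshift R A).
Variable mu : probability (borel_fullshift R A) R.
Hypothesis Fca : cellular_automaton F.

Lemma mean_exponent_ge0 b n : 0 <= mean_exponent mu b F n.
Proof. by apply/fine_ge0/integral_ge0 => x _; rewrite lee_fin. Qed.

Lemma avg_lyap_minusE : avg_lyap_minus mu F =
  limn_einf (fun n => (n%:R^-1 * mean_exponent mu true F n)%:E).
Proof.
have [r Fr] := ca_local_rule Fca; congr limn_einf; apply/funext => n.
have [_ meanE] := mean_exponentE mu true n Fr.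
rewrite EFinM -meanE; congr (_ * _)%E; apply: eq_integral => x _.
by rewrite Iminus_exponent.
Qed.

Lemma avg_lyap_plusE : avg_lyap_plus mu F =
  limn_einf (fun n => (n%:R^-1 * mean_exponent mu false F n)%:E).
Proof.
have [r Fr] := ca_local_rule Fca; congr limn_einf; apply/funext => n.
have [_ meanE] := mean_exponentE mu false n Fr.
rewrite EFinM -meanE; congr (_ * _)%E; apply: eq_integral => x _.
by rewrite Iplus_exponent.
Qed.

Lemma exponents_eq0 : (avg_lyap_plus mu F + avg_lyap_minus mu F = 0)%E ->
  avg_lyap_plus mu F = 0%E /\ avg_lyap_minus mu F = 0%E.
Proof.
have ge0 b n : (0 <= (n%:R^-1 * mean_exponent mu b F n)%:E)%E.
  by rewrite lee_fin mulr_ge0 ?invr_ge0 ?mean_exponent_ge0.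
move=> /eqP; rewrite padde_eq0.
- by move=> /andP[/eqP -> /eqP ->].
- by rewrite avg_lyap_plusE; exact: limn_einf_ge0.
- by rewrite avg_lyap_minusE; exact: limn_einf_ge0.
Qed.

(** The additive constant [c], which is the cost of the window, is absorbed since
    good times are found beyond any bound. *)
Lemma small_cost b (e c : R) N :
  limn_einf (fun n => (n%:R^-1 * mean_exponent mu b F n)%:E) = 0%E -> 0 < e ->
  exists n, [/\ (0 < n)%N, (N <= n)%N &
    (c + mean_exponent mu b F n) * ln (2 * #|A|%:R) <= n%:R * e].
Proof.
move=> lim0 e0; set L := ln (2 * #|A|%:R).
have L0 : 0 < L.
  rewrite ln_gt0// -natrM ltr1n; have : (0 < #|A|)%N by apply/card_gt0P; exists point.
  by lia.
have eL0 : 0 < e / 2 / L by rewrite !divr_gt0.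
have [n] := limn_einf_eq0_frequently (maxn N (Num.trunc (c / (e / 2 / L))).+1) lim0 eL0.
rewrite geq_max => /andP[Nn nc]; rewrite lte_fin => mn; exists n.
have n0 : (0 < n)%N by apply: leq_trans nc.
split=> //; have nR0 : 0 < n%:R :> R by rewrite ltr0n.
rewrite -ler_pdivlMr//; have -> : n%:R * e / L = n%:R * (e / 2 / L) + n%:R * (e / 2 / L).
  by field; rewrite gt_eqF.
apply: lerD; last by rewrite -ler_pdivrMl// ltW.
rewrite -ler_pdivrMr//; apply: ltW; apply: (lt_le_trans (truncnS_gt _)).
by rewrite ler_nat.
Qed.

End vanishing.

Theorem proposition3 (R : realType) (A : finPointedType)
    (F : fullshift R A -> fullshift R A)
    (mu : probability (borel_fullshift R A) R)
    (F_ca : cellular_automaton F)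
    (F_sensitive : sensitive F)
    (mu_shift : invariant_measure mu shift_map)
    (mu_F : invariant_measure mu F)
    (exponents0 : (avg_lyap_plus mu F + avg_lyap_minus mu F = 0)%E) :
  ks_entropy mu F = 0%E.
Proof.
have [r Fr] := ca_local_rule F_ca.
have [plus0 minus0] := exponents_eq0 F_ca exponents0.
rewrite avg_lyap_plusE// in plus0; rewrite avg_lyap_minusE// in minus0.
apply: ks_entropy0 => //; first exact: radius_measurable Fr.
move=> k lbl e mlbl e0; have e40 : 0 < e / 4 by rewrite divr_gt0.
have [p0 [q [qp0 err]]] := local_label_small_error mu e40 mlbl.
(* The window serves both to read [q] and to glue orbits. *)
pose p := maxn r p0; have qp := local_map_mono (leq_maxr r p0) qp0.
have [n [n0 _ Hn]] := small_cost (p + p).+2%:R 0 plus0 e40.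
have [m [m0 nm Hm]] := small_cost (p + p).+2%:R n minus0 e40.
exists m => //.
apply: le_trans (shannon_itinerary_exponents m F_ca Fr (leq_maxl r p0) n0 mu_shift mu_F mlbl qp) _.
have -> : m%:R * e = m%:R * (e / 4) + m.*2%:R * (e / 4) + m%:R * (e / 4).
  by rewrite -muln2 natrM; field.
apply: lerD; first apply: lerD => //.
  apply: (@le_trans _ _ ((m %/ n).+1%:R * (n%:R * (e / 4)))).
    by rewrite ler_pM2l ?ltr0n.
  (* The blocks cover at most [m + n] time steps, and [n <= m]. *)
  rewrite mulrA -natrM ler_pM2r// ler_nat mulSn -addnn.
  by rewrite leq_add// leq_divM.
by rewrite ler_pM2l ?ltr0n.
Qed.
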